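(* The system (S) $$v_a(t)\,\Delta T_{a,u}(t)\le 0,\quad \Delta T_{a,u}(t)\ge T_{a:u}(t)-T_u(t),\quad \Delta T_{a,u}(t)\ge T_u(t)-T_{a:u}(t),\qquad u\in V,\ a\in\delta^{\mathrm{out}}(u),\ t\in\mathcal{T},$$ $$v_a(t)\,\Delta T_{a,u}(t)\ge 0,\quad \Delta T_{a,u}(t)\ge T_{a:u}(t)-T_u(t),\quad \Delta T_{a,u}(t)\ge T_u(t)-T_{a:u}(t),\qquad u\in V,\ a\in\delta^{\mathrm{in}}(u),\ t\in\mathcal{T},$$ is feasible if and only if the temperature propagation equations (P) $$v_a(t)\,|T_{a:u}(t)-T_u(t)|\le 0,\qquad u\in V,\ a\in\delta^{\mathrm{out}}(u),\ t\in\mathcal{T},$$ $$v_a(t)\,|T_{a:u}(t)-T_u(t)|\ge 0,\qquad u\in V,\ a\in\delta^{\mathrm{in}}(u),\ t\in\mathcal{T},$$ are feasible.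
   Context: $G=(V,A)$ is a connected directed graph modeling a district heating network, and $\mathcal{T}=[0,T]$ with $T>0$ is the time horizon. For a node $u\in V$, $\delta^{\mathrm{out}}(u)$ is the set of arcs of the form $(u,w)\in A$, $\delta^{\mathrm{in}}(u)$ is the set of arcs of the form $(w,u)\in A$, and $\delta(u)=\delta^{\mathrm{out}}(u)\cup\delta^{\mathrm{in}}(u)$. The quantities appearing in (P) are: the flow velocity $v_a(t)$ in arc $a\in A$ at time $t$ (it does not depend on the position in the arc); the water temperature $T_{a:u}(t)$ at the end of arc $a\in\delta(u)$ located at node $u$, i.e., $T_{a:u}(t)=T_a(0,t)$ if $a\in\delta^{\mathrm{out}}(u)$ and $T_{a:u}(t)=T_a(L_a,t)$ if $a\in\delta^{\mathrm{in}}(u)$, where $T_a(x,t)$ is the water temperature in arc $a$ at position $x\in[0,L_a]$ and $L_a$ is the length of $a$; and the mixed water temperature $T_u(t)$ at node $u\in V$. The system (S) is obtained from (P) by introducing a new real variable $\Delta T_{a,u}(t)$ for all $u\in V$ and $a\in\delta(u)$, in order to rewrite (P) without absolute values. *)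

(* Defs.v *)
From HB Require Import structures.
From mathcomp Require Import all_boot all_order all_algebra.
From mathcomp Require Import reals.

Set Implicit Arguments.
Unset Strict Implicit.
Unset Printing Implicit Defensive.

Import Order.TTheory GRing.Theory Num.Theory.
Local Open Scope ring_scope.

(* A directed graph on the finite type V is given by its arc set
   A : {set V * V}; the arc (u, w) leaves u and enters w. *)

Definition dout (V : finType) (A : {set V * V}) (u : V) : {set V * V} :=
  [set a in A | a.1 == u].

Definition din (V : finType) (A : {set V * V}) (u : V) : {set V * V} :=
  [set a in A | a.2 == u].

(* Connectedness of a directed graph is that of the underlying undirected
   graph. *)
Definition connected_digraph (V : finType) (A : {set V * V}) : Prop :=
  forall u w : V,
    connect [rel x y | ((x, y) \in A) || ((y, x) \in A)] u w.

(* Time-dependent and space-dependent quantities are total functions on R;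
   only the times in [0, tmax] and the positions 0 and L a are ever used. *)

(* Temperature at the end of the arc a located at u, for a incident to u; Ta a x t
   is the temperature in a at position x and time t. On a loop, where both
   ends are located at u, the start of the arc is chosen. *)
Definition Tend (R : realType) (V : finType) (L : V * V -> R)
    (Ta : V * V -> R -> R -> R) (a : V * V) (u : V) (t : R) : R :=
  if a.1 == u then Ta a 0 t else Ta a (L a) t.

Definition sysP (R : realType) (V : finType) (A : {set V * V})
    (L : V * V -> R) (tmax : R)
    (v : V * V -> R -> R) (Ta : V * V -> R -> R -> R) (Tn : V -> R -> R) :
    Prop :=
  (forall u a t, a \in dout A u -> t \in `[0, tmax] ->
     v a t * `|Tend L Ta a u t - Tn u t| <= 0) /\
  (forall u a t, a \in din A u -> t \in `[0, tmax] ->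
     v a t * `|Tend L Ta a u t - Tn u t| >= 0).

Definition sysS (R : realType) (V : finType) (A : {set V * V})
    (L : V * V -> R) (tmax : R)
    (v : V * V -> R -> R) (Ta : V * V -> R -> R -> R) (Tn : V -> R -> R)
    (dT : V * V -> V -> R -> R) : Prop :=
  (forall u a t, a \in dout A u -> t \in `[0, tmax] ->
     [/\ v a t * dT a u t <= 0,
         dT a u t >= Tend L Ta a u t - Tn u t
       & dT a u t >= Tn u t - Tend L Ta a u t]) /\
  (forall u a t, a \in din A u -> t \in `[0, tmax] ->
     [/\ v a t * dT a u t >= 0,
         dT a u t >= Tend L Ta a u t - Tn u t
       & dT a u t >= Tn u t - Tend L Ta a u t]).

Definition feasibleP (R : realType) (V : finType) (A : {set V * V})
    (L : V * V -> R) (tmax : R) : Prop :=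
  exists v Ta Tn, sysP A L tmax v Ta Tn.

Definition feasibleS (R : realType) (V : finType) (A : {set V * V})
    (L : V * V -> R) (tmax : R) : Prop :=
  exists v Ta Tn dT, sysS A L tmax v Ta Tn dT.

(* Main.v *)
Require Import Defs.
From HB Require Import structures.
From mathcomp Require Import all_boot all_order all_algebra.
From mathcomp Require Import reals.

Import Order.TTheory GRing.Theory Num.Theory.
Local Open Scope ring_scope.

(** Fix [v], [Ta] and [Tn]. The two linear inequalities of (S) say exactly that the slack dominates
    the absolute value in (P). Given (P), that absolute value is itself a slack. Given (S), a
    velocity of the required sign makes (P) immediate; otherwise shrinking the slack to the absolute
    value keeps the sign condition ([mulr_norm_le0], [mulr_norm_ge0]). *)

(* A slack [d >= `|x|] may exceed [`|x|], but it vanishes only if [x] does, so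
   the sign of [v * d] still controls that of [v * `|x|]. *)
Lemma mulr_norm_le0 {R : realDomainType} {v x d : R} :
  `|x| <= d -> v * d <= 0 -> v * `|x| <= 0.
Proof.
move=> le_xd vd_le0; have [v_le0|v_gt0] := leP v 0.
  by rewrite mulr_le0_ge0.
by apply: le_trans vd_le0; rewrite ler_pM2l.
Qed.

(** Negating [v] turns the condition on entering arcs into the one on leaving arcs. *)
Lemma mulr_norm_ge0 {R : realDomainType} {v x d : R} :
  `|x| <= d -> 0 <= v * d -> 0 <= v * `|x|.
Proof.
move=> le_xd vd_ge0; rewrite -oppr_le0 -mulNr.
by apply: (mulr_norm_le0 le_xd); rewrite mulNr oppr_le0.
Qed.

Lemma ler_norm_distl {R : realDomainType} {x y d : R} :
  `|x - y| <= d <-> x - y <= d /\ y - x <= d.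
Proof. by rewrite ler_norml lerNl opprB andbC; split=> /andP. Qed.

(** The equivalence is pointwise: only the slack is quantified, so velocities and temperatures carry
    over unchanged. *)
Lemma sysS_iff_sysP (R : realType) (V : finType) (A : {set V * V})
    (L : V * V -> R) (tmax : R) (v : V * V -> R -> R)
    (Ta : V * V -> R -> R -> R) (Tn : V -> R -> R) :
  (exists dT, sysS A L tmax v Ta Tn dT) <-> sysP A L tmax v Ta Tn.
Proof.
split=> [[dT [outS inS]]|[outP inP]].
  split=> u a t au t_in.
    have [vd dl dr] := outS u a t au t_in.
    by apply: mulr_norm_le0 vd; apply/ler_norm_distl.
  have [vd dl dr] := inS u a t au t_in.
  by apply: mulr_norm_ge0 vd; apply/ler_norm_distl.
(* The tightest slack: its product constraints are literally those of (P). *)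
exists (fun a u t => `|Tend L Ta a u t - Tn u t|).
split=> u a t au t_in; have [dl dr] := ler_norm_distl.1 (lexx `|Tend L Ta a u t - Tn u t|).
  by split=> //; apply: outP.
by split=> //; apply: inP.
Qed.

Theorem theorem2 (R : realType) (V : finType) (A : {set V * V})
    (L : V * V -> R) (tmax : R)
    (hconn : connected_digraph A)
    (hL : forall a, a \in A -> 0 <= L a)
    (htmax : 0 < tmax) :
  (forall (v : V * V -> R -> R) (Ta : V * V -> R -> R -> R) (Tn : V -> R -> R),
     (exists dT : V * V -> V -> R -> R, sysS A L tmax v Ta Tn dT) <->
     sysP A L tmax v Ta Tn) /\
  (feasibleS A L tmax <-> feasibleP A L tmax).
Proof.
split=> [v Ta Tn|]; first exact: sysS_iff_sysP.
by split=> -[v [Ta [Tn /sysS_iff_sysP sys]]]; exists v, Ta, Tn.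
Qed.
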